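(* Let $R$ be a ring, let $\{N_1, N_2, \ldots, N_k\}$ be a collection of ideals of $R$ satisfying the CNC-condition, and let $s_i$ be the characteristic of the ideal $N_i$ in the ideal $N_{i+1}$ for $i=1,\dots,k-1$. Let $f\in R$. Then $f+N_1$ is an invertible element of the ring $R/N_1$ if and only if $f+N_1\subset R^{\ast}$. Furthermore, in this case, for each $x\in f+N_1$, \[x^{-1}=g(xg)^{s_1s_2\cdots s_{k-1}-1},\] where $g\in R$ is any element such that $(f+N_1)(g+N_1)=1+N_1$. Moreover, \[|R^{\ast}|=|(R/N_1)^{\ast}|\,|N_1|.\]
   Context: Rings are associative with identity $1$, not necessarily commutative; ideals are two-sided. $R^{\ast}$ denotes the group of (two-sided) invertible elements of $R$. A collection $\{N_1,\dots,N_k\}$ of ideals of a ring $R$ satisfies the CNC-condition if: (1) (chain condition) $\{0\}=N_k\subset N_{k-1}\subset\cdots\subset N_2\subset N_1\subset R$; (2) (nilpotency condition) for $i=1,\dots,k-1$ there exists an integer $t_i\geq 2$ such that $N_i^{t_i}\subset N_{i+1}$; (3) (characteristic condition) for $i=1,\dots,k-1$ there exists an integer $s_i\geq 1$ such that $s_iN_i\subset N_{i+1}$, and all prime factors of $s_i$ are greater than or equal to $t_i$. The minimum $t_i$ satisfying the nilpotency condition is called the nilpotency index of $N_i$ in $N_{i+1}$; the minimum $s_i$ satisfying the characteristic condition is called the characteristic of $N_i$ in $N_{i+1}$. *)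

(* Defs.v *)
From HB Require Import structures.
From mathcomp Require Import all_boot all_algebra.
From mathcomp Require Import all_classical.

Set Implicit Arguments.
Unset Strict Implicit.
Unset Printing Implicit Defensive.

Import GRing.Theory.

Local Open Scope classical_set_scope.
Local Open Scope ring_scope.
Local Open Scope quotient_scope.

(* The library's idealr is one-sided and proper, and it only makes             *)
(* {ideal_quot I} a ring over commutative nonzero rings; hence the structure  *)
(* below. Ideals are boolean predicates as in ring_quotient; classically      *)
(* (asbool) this is no restriction. The whole ring is allowed.                *)
HB.mixin Record isTwoSidedIdeal (R : pzRingType) (S : R -> bool) := {
  ideal_mull_subproof : forall a x : R, x \in (S : {pred R}) ->
    a * x \in (S : {pred R});
  ideal_mulr_subproof : forall a x : R, x \in (S : {pred R}) ->
    x * a \in (S : {pred R})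
}.

#[short(type="ideal")]
HB.structure Definition TwoSidedIdeal (R : pzRingType) :=
  {S of GRing.ZmodClosed R S & isTwoSidedIdeal R S}.

(* An alias: the canonical ring structures of {ideal_quot I} itself are       *)
(* already taken by the library's commutative ones.                           *)
Definition quot_ring (R : pzRingType) (I : ideal R) : Type := {ideal_quot I}.

Section QuotientRing.
Variables (R : pzRingType) (idealI : ideal R).
Local Notation I := (idealI : {pred R}).
Local Notation Q := (quot_ring idealI).

HB.instance Definition _ := Choice.on Q.
HB.instance Definition _ := ZmodQuotient.on Q.

Lemma ideal_mull a x : x \in I -> a * x \in I.
Proof. exact: ideal_mull_subproof. Qed.

Lemma ideal_mulr a x : x \in I -> x * a \in I.
Proof. exact: ideal_mulr_subproof. Qed.

Definition quot_one : Q := lift_cst Q 1.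
Definition quot_mul := lift_op2 Q *%R.

Canonical pi_quot_one_morph := PiConst quot_one.

Lemma pi_quot_mul : {morph \pi_Q : x y / x * y >-> quot_mul x y}.
Proof.
move=> x y; unlock quot_mul; apply/eqP; rewrite piE Quotient.equivE.
rewrite -[_ * _](addrNK (x * repr (\pi_Q y))) -mulrBr -addrA -mulrBl rpredD //.
  by rewrite ideal_mull // Quotient.idealrDE opprK reprK.
by rewrite ideal_mulr // Quotient.idealrDE opprK reprK.
Qed.
Canonical pi_quot_mul_morph := PiMorph2 pi_quot_mul.

Lemma quot_mulA : associative quot_mul.
Proof. by move=> x y z; rewrite -[x]reprK -[y]reprK -[z]reprK !piE mulrA. Qed.

Lemma quot_mul1 : left_id quot_one quot_mul.
Proof. by move=> x; rewrite -[x]reprK !piE mul1r. Qed.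

Lemma quot_1mul : right_id quot_one quot_mul.
Proof. by move=> x; rewrite -[x]reprK !piE mulr1. Qed.

Lemma quot_mulDl : left_distributive quot_mul +%R.
Proof.
move=> x y z; rewrite -[x]reprK -[y]reprK -[z]reprK.
by rewrite !piE mulrDl.
Qed.

Lemma quot_mulDr : right_distributive quot_mul +%R.
Proof.
move=> x y z; rewrite -[x]reprK -[y]reprK -[z]reprK.
by rewrite !piE mulrDr.
Qed.

HB.instance Definition _ := GRing.Zmodule_isPzRing.Build Q
  quot_mulA quot_mul1 quot_1mul quot_mulDl quot_mulDr.

End QuotientRing.

(* The zero ring is allowed, so GRing.unit and _^-1 are not available. *)
Definition is_inverse (R : pzRingType) (x y : R) : Prop :=
  x * y = 1 /\ y * x = 1.

Definition units (R : pzRingType) : set R :=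
  [set x | exists y, is_inverse x y].
Arguments units : clear implicits.

Definition coset (R : pzRingType) (f : R) (I : ideal R) : set R :=
  [set f + n | n in [set` I]].

Lemma pi_eq_coset (R : pzRingType) (I : ideal R) (f g : R) :
  \pi_(quot_ring I) f = \pi_(quot_ring I) g <-> coset f I = coset g I.
Proof.
split=> [/eqP|fg].
  rewrite -Quotient.idealrBE => fgI; apply/seteqP; split=> _ [n /= nI <-].
    exists (f - g + n) => /=; first exact: rpredD.
    by rewrite addrA subrKC.
  exists (n - (f - g)) => /=; first exact: rpredB.
  by rewrite opprB addrCA subrKC addrC.
have : coset f I f by exists 0; rewrite /= ?rpred0 ?addr0.
rewrite fg => -[n /= nI gnf]; apply/eqP.
by rewrite -Quotient.idealrBE -gnf addrC addKr.
Qed.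

Definition ideal_mul (R : pzRingType) (A B : set R) : set R :=
  [set x | exists (n : nat) (a b : 'I_n -> R),
     [/\ forall i, A (a i), forall i, B (b i) & x = \sum_(i < n) a i * b i]].

Fixpoint ideal_exp (R : pzRingType) (A : set R) (n : nat) : set R :=
  if n is n'.+1 then ideal_mul A (ideal_exp A n') else setT.

Definition nilpotency_cond (R : pzRingType) (I J : ideal R) (t : nat) : Prop :=
  (2 <= t)%N /\ ideal_exp [set` I] t `<=` [set` J].

Definition characteristic_cond (R : pzRingType) (I J : ideal R) (t s : nat)
    : Prop :=
  [/\ (1 <= s)%N,
      [set x *+ s | x in [set` I]] `<=` [set` J] &
      forall p : nat, prime p -> (p %| s)%N -> (t <= p)%N].

Definition is_minimum (P : nat -> Prop) (n : nat) : Prop :=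
  P n /\ forall m : nat, P m -> (n <= m)%N.

Definition nilpotency_index (R : pzRingType) (I J : ideal R) (t : nat) : Prop :=
  is_minimum (nilpotency_cond I J) t.

(* The bound on the prime factors of s is taken with respect to the           *)
(* nilpotency index. The value does not depend on this choice: if some s      *)
(* satisfies the condition for some t, the least one is the exponent of the   *)
(* additive group I / (I `&` J), as this exponent divides s.                  *)
Definition characteristic (R : pzRingType) (I J : ideal R) (s : nat) : Prop :=
  exists2 t : nat, nilpotency_index I J t &
    is_minimum (characteristic_cond I J t) s.

(* The collection is N 1, ..., N k; the other values of N are irrelevant. *)
Definition CNC (R : pzRingType) (k : nat) (N : nat -> ideal R) : Prop :=
  [/\ (1 <= k)%N,
      [set` N k] = [set 0],
      forall i : nat, (1 <= i < k)%N -> [set` N i.+1] `<=` [set` N i] &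
      forall i : nat, (1 <= i < k)%N -> exists t s : nat,
        nilpotency_cond (N i) (N i.+1) t /\
        characteristic_cond (N i) (N i.+1) t s].

(* Main.v *)
Require Import Defs.
From mathcomp Require Import all_boot all_algebra.
From mathcomp Require Import all_classical.

(** Write [S] for the product of the characteristics [s i]. Everything rests on
    one fact: each [u] in [1 + N_1] satisfies [u ^+ S = 1].

    It suffices to go down one step of the chain: if [u] lies in [1 + I], then
    [u ^+ s] lies in [1 + J], where [t] and [s] are the nilpotency index and the
    characteristic of [I] in [J] ([expr_char_sub1_in]). Expand
    [(n + 1) ^+ s] with [n] in [I]. The terms [n ^+ j] with [j >= t] lie in [J]
    by nilpotency. For [0 < j < t] the coefficient ['C(s, j)] is a multiple of
    [s], because the prime factors of [s] are at least [t]
    ([dvdn_bin_large_primes]), and [s] sends [I] into [J]. Iterating along the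
    chain puts [u ^+ S - 1] in [N_k = 0] ([CNC_expr_prod]).

    Now let [f g = 1] modulo [N_1] with [f] invertible modulo [N_1], and let [x]
    be in [f + N_1]. Both [x g] and [g x] lie in [1 + N_1], so their powers of
    exponent [S] are [1]; this says that [g (x g) ^+ (S - 1)] is a right and a
    left inverse of [x] ([coset_inverse]). Hence the units of [R] are exactly
    the elements above the units of [R / N_1], a disjoint union of
    [#|(R / N_1)^*|] cosets of [N_1] ([card_units_lift]). *)

Set Implicit Arguments.
Unset Strict Implicit.
Unset Printing Implicit Defensive.

Import GRing.Theory.

Local Open Scope classical_set_scope.
Local Open Scope card_scope.
Local Open Scope ring_scope.
Local Open Scope quotient_scope.


(** From [j * 'C(s, j) = s * 'C(s - 1, j - 1)]: a prime dividing [j] is less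
    than [t], so that [j] is coprime to [s] and can be cancelled. *)
Lemma dvdn_bin_large_primes (s t j : nat) :
    (forall p : nat, prime p -> (p %| s)%N -> (t <= p)%N) ->
  (0 < j < t)%N -> (s %| 'C(s, j))%N.
Proof.
move=> s_large /andP[j_gt0 lt_jt].
have [->|s_gt0] := posnP s; first by rewrite bin0n gtn_eqF.
have co_sj : coprime s j.
  rewrite coprime_has_primes //; apply/hasPn => p.
  rewrite mem_primes => /and3P[p_pr _ p_dvdj].
  rewrite /= mem_primes p_pr s_gt0 /=; apply/negP => /(s_large _ p_pr) le_tp.
  have := leq_trans lt_jt (leq_trans le_tp (dvdn_leq j_gt0 p_dvdj)).
  by rewrite ltnn.
rewrite -(Gauss_dvdr _ co_sj) -(prednK j_gt0) -mul_bin_diag.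
exact: dvdn_mulr.
Qed.

Lemma ideal_exp_expr (R : pzRingType) (A : set R) (x : R) (n : nat) :
  A x -> ideal_exp A n (x ^+ n).
Proof.
move=> Ax; elim: n => [//|n IHn] /=.
exists 1%N, (fun=> x), (fun=> x ^+ n); split=> //.
by rewrite big_ord1 exprS.
Qed.

Lemma ideal_expr (R : pzRingType) (I : ideal R) (x : R) (n : nat) :
  (0 < n)%N -> x \in I -> x ^+ n \in I.
Proof. by case: n => // n _ xI; rewrite exprSr; apply: ideal_mull. Qed.

(** Raising to the characteristic goes one step down the chain. In the
    expansion of [(n + 1) ^+ s] with [n = u - 1], the characteristic takes care
    of the terms of degree less than [t], and nilpotency of the others. *)
Lemma expr_char_sub1_in (R : pzRingType) (I J : ideal R) (t s : nat) (u : R) :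
    nilpotency_cond I J t -> characteristic_cond I J t s ->
  u - 1 \in I -> u ^+ s - 1 \in J.
Proof.
move=> [_ nilI] [s_gt0 charI s_large]; set n := u - 1 => nI.
have -> : u = n + 1 by rewrite /n subrK.
rewrite exprD1n big_ord_recl /= expr0 bin0 mulr1n addrC addKr.
apply: rpred_sum => i _; rewrite /bump leq0n add1n.
have [le_ti|lt_it] := leqP t i.+1.
  apply: rpredMn; rewrite -(subnK le_ti) exprD; apply: ideal_mull.
  by apply: nilI; apply: ideal_exp_expr.
have /dvdnP[c ->] : (s %| 'C(s, i.+1))%N.
  by apply: (dvdn_bin_large_primes s_large).
rewrite mulnC mulrnA; apply: rpredMn.
by apply: charI; exists (n ^+ i.+1) => //=; apply: ideal_expr.
Qed.

Lemma CNC_expr_prod (R : pzRingType) (k : nat) (N : nat -> ideal R)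
    (s : nat -> nat) (u : R) :
    CNC k N ->
    (forall i : nat, (1 <= i < k)%N -> characteristic (N i) (N i.+1) (s i)) ->
  u - 1 \in N 1%N -> u ^+ (\prod_(1 <= i < k) s i)%N = 1.
Proof.
move=> [k_gt0 Nk0 _ _] hs uN1.
suff uN j : (1 <= j <= k)%N -> u ^+ (\prod_(1 <= i < j) s i)%N - 1 \in N j.
  have : [set` N k] (u ^+ (\prod_(1 <= i < k) s i)%N - 1).
    by rewrite /= uN // k_gt0 leqnn.
  by rewrite Nk0 => /eqP; rewrite subr_eq0 => /eqP.
case: j => // j; elim: j => [|j IHj] /= lt_jk.
  by rewrite big_geq // expr1.
have [t [nilt _] [chart _]] := hs j.+1 lt_jk.
rewrite big_nat_recr //= exprM.
by apply: (expr_char_sub1_in nilt chart); apply: IHj; apply: ltnW.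
Qed.

Lemma characteristic_prod_gt0 (R : pzRingType) (k : nat) (N : nat -> ideal R)
    (s : nat -> nat) :
    (forall i : nat, (1 <= i < k)%N -> characteristic (N i) (N i.+1) (s i)) ->
  (0 < \prod_(1 <= i < k) s i)%N.
Proof.
move=> hs; rewrite big_nat_cond; apply: prodn_cond_gt0 => i /andP[ik _].
by have [t _ [[]]] := hs i ik.
Qed.

Section Quotient.
Variables (R : pzRingType) (I : ideal R).
Implicit Types f g x y : R.

Local Notation Q := (quot_ring I).
Local Notation pi := (\pi_(quot_ring I)).

Lemma pi_quot1 : pi 1 = 1 :> Q.
Proof. by rewrite piE. Qed.

Lemma pi_quotM x y : pi (x * y) = pi x * pi y :> Q.
Proof. exact: pi_quot_mul. Qed.

Lemma pi_quot_eqP x y : reflect (pi x = pi y :> Q) (x - y \in I).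
Proof. by rewrite Quotient.idealrBE; apply: eqP. Qed.

Lemma cosetP f x : coset f I x <-> pi x = pi f :> Q.
Proof.
split=> [[n /= nI <-]|/pi_quot_eqP xfI].
  by apply/pi_quot_eqP; rewrite addrC addKr.
by exists (x - f) => //; rewrite addrC subrK.
Qed.

Lemma units_pi f : units R f -> units Q (pi f).
Proof.
by move=> [g [fg gf]]; exists (pi g); split; rewrite -pi_quotM ?fg ?gf pi_quot1.
Qed.

Section Exponent.
Variable S : nat.
Hypothesis S_gt0 : (0 < S)%N.
Hypothesis expr_eq1 : forall u : R, u - 1 \in I -> u ^+ S = 1.

(** The left inverse comes from [(g x) ^+ S = g (x g) ^+ (S - 1) x] and
    [g x = 1] modulo [I]; for the latter, the invertibility of [f] modulo [I]
    makes its right inverse two-sided. *)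
Lemma coset_inverse f x g :
    units Q (pi f) -> coset f I x -> pi f * pi g = 1 :> Q ->
  is_inverse x (g * (x * g) ^+ (S - 1)).
Proof.
move=> [h [fh hf]] /cosetP xf fg.
have gf : pi g * pi f = 1 :> Q.
  by rewrite -[pi g]mul1r -hf -[h * _ * _]mulrA fg mulr1.
have xgS : (x * g) ^+ S = 1.
  by apply/expr_eq1/pi_quot_eqP; rewrite pi_quotM xf fg pi_quot1.
have gxS : (g * x) ^+ S = 1.
  by apply/expr_eq1/pi_quot_eqP; rewrite pi_quotM xf gf pi_quot1.
have shift m : g * (x * g) ^+ m = (g * x) ^+ m * g.
  elim: m => [|m IHm]; first by rewrite !expr0 mulr1 mul1r.
  by rewrite exprSr mulrA IHm exprSr !mulrA.
split; first by rewrite mulrA -exprS subn1 prednK.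
by rewrite shift -mulrA -exprSr subn1 prednK.
Qed.

Lemma units_lift f : units Q (pi f) -> coset f I `<=` units R.
Proof.
move=> uf x xf; have [h [fh hf]] := uf.
exists (repr h * (x * repr h) ^+ (S - 1)).
by apply: (coset_inverse uf xf); rewrite reprK.
Qed.

End Exponent.

(** A unit is determined by its class and by its difference with the chosen
    representative of that class; conversely, each pair of a unit class and an
    element of [I] occurs because units lift. *)
Lemma card_units_lift :
    (forall f, units Q (pi f) -> coset f I `<=` units R) ->
  units R #= units Q `*` [set` I].
Proof.
move=> lift; pose split_unit x : Q * R := (pi x, x - repr (pi x)).
have repr_pi x : x - repr (pi x) \in I by apply/pi_quot_eqP; rewrite reprK.
have inj : {in units R &, injective split_unit}.
  by move=> x y _ _ [-> /addIr].
suff <- : split_unit @` units R = units Q `*` [set` I].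
  by rewrite card_eq_sym; apply: inj_card_eq.
apply/seteqP; split=> [_ [x ux <-]|[q n] [/= uq nI]].
  by split=> /=; [apply: units_pi | apply: repr_pi].
have pi_rn : pi (repr q + n) = q :> Q.
  by rewrite -[RHS]reprK; apply/pi_quot_eqP; rewrite addrC addKr.
exists (repr q + n); last by rewrite /split_unit pi_rn addrC addKr.
by apply: (lift (repr q)); [rewrite reprK | exists n].
Qed.

End Quotient.

Theorem theorem3p3 (R : pzRingType) (k : nat) (N : nat -> ideal R)
    (s : nat -> nat)
    (hN : CNC k N)
    (hs : forall i : nat, (1 <= i < k)%N -> characteristic (N i) (N i.+1) (s i)) :
  (forall f : R,
     (units (quot_ring (N 1%N)) (\pi_(quot_ring (N 1%N)) f) <->
        coset f (N 1%N) `<=` units R) /\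
     (units (quot_ring (N 1%N)) (\pi_(quot_ring (N 1%N)) f) ->
        forall x : R, coset f (N 1%N) x ->
        forall g : R,
          \pi_(quot_ring (N 1%N)) f * \pi_(quot_ring (N 1%N)) g
            = 1 :> (quot_ring (N 1%N)) ->
          is_inverse x (g * (x * g) ^+ (\prod_(1 <= i < k) s i - 1)%N))) /\
  (units R #= units (quot_ring (N 1%N)) `*` [set` N 1%N]).
Proof.
have S_gt0 := characteristic_prod_gt0 hs.
have expr_eq1 u := CNC_expr_prod hN hs (u := u).
have lift := units_lift S_gt0 expr_eq1.
split; last exact: card_units_lift.
move=> f; split; last first.
  by move=> uf x xf g; apply: (coset_inverse S_gt0 expr_eq1).
split; first exact: lift.
by move=> cf; apply/units_pi/cf/cosetP.
Qed.
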